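(* Let $L \subseteq \mathbb{N}$ be finite. Let $S$ be a c.e. or co-c.e. set of halting algorithms for computable measures on $L^{\infty}$. Suppose we are given an infinite sequence $x_1, x_2, \ldots$ of elements of $L$ which is typical (Martin-Löf random) for at least one measure whose algorithm is in $S$. Then there is an algorithm that, given access to an (co-)enumeration of $S$ and to the sequence, outputs an infinite sequence of indices $i_1, i_2, \ldots$ such that there exist $n_0$ and an index $k$ with $i_n = k$ for all $n \ge n_0$. Here $k$ indexes a computable measure in $S$ for which $x_1,x_2,\ldots$ is typical. In other words, the algorithm identifies in the limit a computable measure for which the sequence is typical. The final guess is a finite code (a Turing machine), and it is fixed after only a finite, though unknown, initial segment of the data has been read.
   Context: For a finite string $x=x_1\ldots x_n\in L^*$, the cylinder $\Gamma_x$ is the set of infinite sequences in $L^\infty$ beginning with $x$; write $\mu(x)$ for $\mu(\Gamma_x)$. A measure on $L^\infty$ is determined by values $\mu(x)$, $x\in L^*$, with $\mu(\epsilon)=1$ ($\epsilon$ the empty string) and $\mu(x)=\sum_{a\in L}\mu(xa)$ for all $x$. It is computable if there is an algorithm computing $\mu(x)$ to any rational precision given $x$. A ''halting algorithm for a computable measure'' is an index of such an algorithm. A set $S$ of such indices is c.e. if some algorithm lists exactly its elements. It is co-c.e. if its complement, within the standard enumeration of algorithms, is c.e. $K(x)$ denotes the prefix Kolmogorov complexity of $x$ with respect to a fixed optimal universal prefix Turing machine, with strings over $L$ encoded in binary. An infinite sequence $x_1,x_2,\ldots$ over $L$ is typical (random) for a computable measure $\mu$ iff $\sup_n \{\log \frac{1}{\mu(x_1\ldots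 x_n)} - K(x_1\ldots x_n)\} < \infty$. A sequence may be typical for several different measures. *)

(* Defs.v *)
From Stdlib Require Import Reals.
From mathcomp Require Import all_boot.

Set Implicit Arguments.
Unset Strict Implicit.
Unset Printing Implicit Defensive.

Definition cpair (x y : nat) : nat := ((x + y) * (x + y).+1)./2 + y.

Fixpoint cunpair (n : nat) : nat * nat :=
  match n with
  | 0 => (0, 0)
  | n'.+1 => let: (x, y) := cunpair n' in
             if x is x'.+1 then (x', y.+1) else (y.+1, 0)
  end.

Inductive term : Type :=
| TZero | TSucc | TFst | TSnd
| TPair of term & term
| TComp of term & term
| TRec of term & term
| TMu of term
| TOrc of nat.

Section Eval.
Variable o : nat -> nat -> nat.

Inductive ev : term -> nat -> nat -> Prop :=
| evZero x : ev TZero x 0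
| evSucc x : ev TSucc x x.+1
| evFst x : ev TFst x (cunpair x).1
| evSnd x : ev TSnd x (cunpair x).2
| evPair f g x a b : ev f x a -> ev g x b -> ev (TPair f g) x (cpair a b)
| evComp f g x y z : ev g x y -> ev f y z -> ev (TComp f g) x z
| evRec0 f g x y : ev f x y -> ev (TRec f g) (cpair 0 x) y
| evRecS f g n x y z : ev (TRec f g) (cpair n x) y ->
    ev g (cpair n (cpair y x)) z -> ev (TRec f g) (cpair n.+1 x) z
| evMu f x n : ev f (cpair n x) 0 ->
    (forall m, m < n -> exists v, v <> 0 /\ ev f (cpair m x) v) ->
    ev (TMu f) x n
| evOrc j x : ev (TOrc j) x (o j x).
End Eval.

Definition noorc : nat -> nat -> nat := fun _ _ => 0.

Fixpoint enc (t : term) : GenTree.tree nat :=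
  match t with
  | TZero => GenTree.Node 0 [::]
  | TSucc => GenTree.Node 1 [::]
  | TFst => GenTree.Node 2 [::]
  | TSnd => GenTree.Node 3 [::]
  | TPair f g => GenTree.Node 4 [:: enc f; enc g]
  | TComp f g => GenTree.Node 5 [:: enc f; enc g]
  | TRec f g => GenTree.Node 6 [:: enc f; enc g]
  | TMu f => GenTree.Node 7 [:: enc f]
  | TOrc j => GenTree.Leaf j
  end.

Fixpoint dec (t : GenTree.tree nat) : term :=
  match t with
  | GenTree.Leaf j => TOrc j
  | GenTree.Node 0 _ => TZero
  | GenTree.Node 1 _ => TSucc
  | GenTree.Node 2 _ => TFst
  | GenTree.Node 3 _ => TSnd
  | GenTree.Node 4 [:: a; b] => TPair (dec a) (dec b)
  | GenTree.Node 5 [:: a; b] => TComp (dec a) (dec b)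
  | GenTree.Node 6 [:: a; b] => TRec (dec a) (dec b)
  | GenTree.Node 7 [:: a] => TMu (dec a)
  | _ => TZero
  end.

Definition alg (e : nat) : term :=
  if unpickle e is Some t then dec t else TZero.
Definition index_of (t : term) : nat := pickle (enc t).

Definition runs (e x y : nat) : Prop := ev noorc (alg e) x y.

Definition computable_fun (g : nat -> nat) : Prop :=
  exists e, forall m, runs e m (g m).

Definition enumerates (g : nat -> nat) (S : nat -> Prop) : Prop :=
  forall e, S e <-> exists m, g m = e.
Definition ce (S : nat -> Prop) : Prop :=
  (forall e, ~ S e) \/ exists g, computable_fun g /\ enumerates g S.
Definition coce (S : nat -> Prop) : Prop := ce (fun e => ~ S e).

(* Measures on L^oo given by their values on cylinders.                      *)
Definition over (L : seq nat) (w : seq nat) : bool := all (fun a => a \in L) w.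

Definition is_measure (L : seq nat) (mu : seq nat -> R) : Prop :=
  mu [::] = R1 /\
  (forall w, over L w -> Rle R0 (mu w)) /\
  (forall w, over L w -> mu w = \big[Rplus/R0]_(a <- L) mu (rcons w a)).

Definition qdec (r : nat) : R :=
  Rdiv (INR (cunpair r).1) (INR (cunpair r).2.+1).

Definition computes_measure (L : seq nat) (e : nat) (mu : seq nat -> R) : Prop :=
  forall w, over L w -> forall n, exists r,
    runs e (cpair (pickle w) n) r /\ Rle (Rabs (Rminus (mu w) (qdec r))) (Rinv (pow 2 n)).

Definition measure_alg (L : seq nat) (e : nat) : Prop :=
  exists mu, is_measure L mu /\ computes_measure L e mu.

Definition pmrun (M : nat) (p : seq bool) (y : nat) : Prop := runs M (pickle p) y.

Definition prefix_machine (M : nat) : Prop :=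
  forall p q y z, pmrun M p y -> pmrun M q z -> prefix p q -> p = q.

Definition universal_prefix_machine (U : nat) : Prop :=
  prefix_machine U /\
  forall M, prefix_machine M ->
    exists sigma : seq bool, forall p y, pmrun U (sigma ++ p) y <-> pmrun M p y.

Definition Kc (U : nat) (y k : nat) : Prop :=
  (exists p, size p = k /\ pmrun U p y) /\ (forall p, pmrun U p y -> k <= size p).

Definition log2 (x : R) : R := Rdiv (ln x) (ln 2).

(* x_1 x_2 ... (indexed from 0 here) restricted to its first n letters. *)
Definition init (x : nat -> nat) (n : nat) : seq nat := mkseq x n.

(* Martin-Lof typicality via the Levin-Gacs / Schnorr criterion. *)
Definition typical (U : nat) (mu : seq nat -> R) (x : nat -> nat) : Prop :=
  exists c : R, forall n, Rlt R0 (mu (init x n)) /\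
    forall k, Kc U (pickle (init x n)) k ->
      Rle (Rminus (log2 (Rinv (mu (init x n)))) (INR k)) c.

Definition typical_for_alg (L : seq nat) (U e : nat) (x : nat -> nat) : Prop :=
  exists mu, computes_measure L e mu /\ typical U mu x.

(* Learners: oracle algorithms.  Oracle 0 = the (co-)enumeration g,           *)
(* oracle 1 = the data sequence, of which at stage n only x_0..x_{n-1} are    *)
(* visible.  At stage n the learner outputs its guess i_n.                     *)
Definition learner_oracles (g x : nat -> nat) (n : nat) : nat -> nat -> nat :=
  fun j m => if j == 0 then g m else if m < n then x m else 0.

Definition guess (A : term) (g x : nat -> nat) (n i : nat) : Prop :=
  ev (learner_oracles g x n) A n i.

Definition identifies (L : seq nat) (U : nat) (S : nat -> Prop) (A : term)
  (g x : nat -> nat) : Prop :=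
  (forall n, exists i, guess A g x n i) /\
  exists n0 k, S k /\ typical_for_alg L U k x /\
    forall n, n0 <= n -> guess A g x n k.

(* Main.v *)
(* Call a pair (e, c) refuted once some program p of length k makes U print a
   prefix w of the data while the algorithm e shows mu_e(w) < 2^-(k+c).
   Refutation is semi-decidable, since halting computations are found by a
   step-bounded universal machine, and for e computing a measure (e, c) is never
   refuted iff the deficiency log (1 / mu_e(w)) - K(w) is bounded by c along the
   data.  For a co-c.e. S, the appearance of e in the enumeration of the
   complement also refutes (e, c).  Guessing at each stage the first pair (in
   a fixed listing of the pairs with e in S, resp. of all pairs) not yet
   refuted converges, because each of the finitely many pairs below the least
   irrefutable one is eventually discarded. *)
Require Import Defs.
From Stdlib Require Import Reals Lra Classical.
From mathcomp Require Import all_boot.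
From mathcomp Require Import zify.

Set Implicit Arguments.
Unset Strict Implicit.
Unset Printing Implicit Defensive.

(** * The pairing of numbers and its inverse *)

Definition pf (n : nat) : nat := (cunpair n).1.
Definition ps (n : nat) : nat := (cunpair n).2.

(** Together with [cpair_S0]: [cpair] numbers the antidiagonals in the order in which the recursion
    of [cunpair] walks them. *)
Lemma cpairS x y : cpair x y.+1 = (cpair x.+1 y).+1.
Proof. by rewrite /cpair addnS addSn addnS. Qed.

Lemma cpair_S0 x : cpair x.+1 0 = (cpair 0 x).+1.
Proof.
rewrite /cpair !addn0 add0n.
have -> : x.+1 * x.+2 = x * x.+1 + x.+1.*2 by lia.
by rewrite halfD odd_double andbF doubleK addnS.
Qed.

Lemma cunpairS n : cunpair n.+1 =
  if (cunpair n).1 is x.+1 then (x, (cunpair n).2.+1) else ((cunpair n).2.+1, 0).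
Proof. by move=> /=; case: (cunpair n) => -[]. Qed.

Lemma cpairK x y : cunpair (cpair x y) = (x, y).
Proof.
(* Induction on the code, not on the components: one step back lowers the code by one but may raise
   [x]. *)
move: {2}(cpair x y) (erefl (cpair x y)) => n; elim: n x y => [|n IH] x y.
  by case: y => [|y]; [case: x => [|x] //; rewrite cpair_S0 | rewrite cpairS].
case: y => [|y]; first case: x => [|x] //.
  by rewrite cpair_S0 => -[/IH E]; rewrite cunpairS E.
by rewrite cpairS => -[/IH E]; rewrite cunpairS E.
Qed.

Lemma pfE x y : pf (cpair x y) = x. Proof. by rewrite /pf cpairK. Qed.
Lemma psE x y : ps (cpair x y) = y. Proof. by rewrite /ps cpairK. Qed.
Definition pE := (pfE, psE).

Lemma cpair_pfps n : cpair (pf n) (ps n) = n.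
Proof.
rewrite /pf /ps; elim: n => //= n; case: (cunpair n) => -[|x] y /= IH.
  by rewrite cpair_S0 IH.
by rewrite cpairS IH.
Qed.

Lemma pfps_le n : pf n + ps n <= n.
Proof.
rewrite /pf /ps; elim: n => //= n; case: (cunpair n) => -[|x] y /=; lia.
Qed.
Lemma pf_le n : pf n <= n. Proof. have := pfps_le n; lia. Qed.
Lemma ps_le n : ps n <= n. Proof. have := pfps_le n; lia. Qed.

Lemma ps_lt_cpairS a l : l < (cpair a l).+1.
Proof. by rewrite ltnS -{1}[l](psE a) ps_le. Qed.

(* Otherwise [simpl] unfolds the quadratic formula on numeral tags. *)
#[global] Arguments cpair : simpl never.
#[global] Arguments pf : simpl never.
#[global] Arguments ps : simpl never.

(** * Functions computable uniformly in the oracle *)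

(** One term must serve all oracles, since a single learner faces every enumeration and every data
    sequence. *)
Definition cmp (F : (nat -> nat -> nat) -> nat -> nat) : Prop :=
  exists t, forall o x, ev o t x (F o x).

Lemma cmp_ext F G : (forall o x, F o x = G o x) -> cmp F -> cmp G.
Proof. by move=> E [t H]; exists t => o x; rewrite -E. Qed.

Lemma cmp_pf0 : cmp (fun _ x => pf x).
Proof. by exists TFst => o x; constructor. Qed.
Lemma cmp_ps0 : cmp (fun _ x => ps x).
Proof. by exists TSnd => o x; constructor. Qed.
Lemma cmp_S0 : cmp (fun _ x => x.+1).
Proof. by exists TSucc => o x; constructor. Qed.

Lemma cmp_pair F G : cmp F -> cmp G -> cmp (fun o x => cpair (F o x) (G o x)).
Proof.
move=> [f Hf] [g Hg]; exists (TPair f g) => o x; by constructor.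
Qed.

Lemma cmp_comp F G : cmp F -> cmp G -> cmp (fun o x => F o (G o x)).
Proof.
move=> [f Hf] [g Hg]; exists (TComp f g) => o x; by econstructor.
Qed.

Lemma cmp_comp2 (F : (nat -> nat -> nat) -> nat -> nat -> nat) G H :
  cmp (fun o z => F o (pf z) (ps z)) -> cmp G -> cmp H ->
  cmp (fun o x => F o (G o x) (H o x)).
Proof.
move=> hF hG hH; apply: cmp_ext (cmp_comp hF (cmp_pair hG hH)) => o x /=.
by rewrite !pE.
Qed.

Lemma cmp_comp3 (F : (nat -> nat -> nat) -> nat -> nat -> nat -> nat) G H I :
  cmp (fun o z => F o (pf z) (pf (ps z)) (ps (ps z))) ->
  cmp G -> cmp H -> cmp I ->
  cmp (fun o x => F o (G o x) (H o x) (I o x)).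
Proof.
move=> hF hG hH hI.
apply: cmp_ext (cmp_comp hF (cmp_pair hG (cmp_pair hH hI))) => o x /=.
by rewrite !pE.
Qed.

Lemma cmp_id : cmp (fun _ x => x).
Proof.
by apply: cmp_ext (cmp_pair cmp_pf0 cmp_ps0) => o x; rewrite cpair_pfps.
Qed.

Lemma cmp_pf F : cmp F -> cmp (fun o x => pf (F o x)).
Proof. exact: (cmp_comp cmp_pf0). Qed.
Lemma cmp_ps F : cmp F -> cmp (fun o x => ps (F o x)).
Proof. exact: (cmp_comp cmp_ps0). Qed.
Lemma cmp_succ F : cmp F -> cmp (fun o x => (F o x).+1).
Proof. exact: (cmp_comp cmp_S0). Qed.

Lemma cmp_const c : cmp (fun _ _ => c).
Proof.
elim: c => [|c IH]; last exact: cmp_succ.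
by exists TZero => o x; constructor.
Qed.

Lemma cmp_orc j F : cmp F -> cmp (fun o x => o j (F o x)).
Proof.
by apply: (@cmp_comp (fun o x => o j x)); exists (TOrc j) => o x; constructor.
Qed.

(** The projections in the step hypothesis follow the order in which [TRec] feeds its step term:
    counter, value so far, parameter. *)
Lemma cmp_rec (B N : (nat -> nat -> nat) -> nat -> nat)
    (St : (nat -> nat -> nat) -> nat -> nat -> nat -> nat) :
  cmp B -> cmp (fun o z => St o (ps (ps z)) (pf z) (pf (ps z))) -> cmp N ->
  cmp (fun o x => nat_rect (fun _ => nat) (B o x) (St o x) (N o x)).
Proof.
move=> [f Hf] [g Hg] hN.
suff H : cmp (fun o z =>
    nat_rect (fun _ => nat) (B o (ps z)) (St o (ps z)) (pf z)).
  apply: cmp_ext (cmp_comp H (cmp_pair hN cmp_id)) => o x /=.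
  by rewrite !pE.
exists (TRec f g) => o z; rewrite -{1}(cpair_pfps z).
move: (pf z) (ps z) => n {}z; elim: n => [|n IH] /=; first by constructor.
apply: evRecS IH _; set y := nat_rect _ _ _ _.
by have := Hg o (cpair n (cpair y z)); rewrite !pE.
Qed.

Lemma cmp_iter (B N : (nat -> nat -> nat) -> nat -> nat)
    (St : (nat -> nat -> nat) -> nat -> nat -> nat) :
  cmp B -> cmp (fun o z => St o (ps z) (pf z)) -> cmp N ->
  cmp (fun o x => iter (N o x) (St o x) (B o x)).
Proof.
move=> hB hS hN.
have hS' : cmp (fun o z => St o (ps (ps z)) (pf (ps z))).
  exact: (cmp_comp hS (cmp_ps cmp_id)).
apply: cmp_ext (@cmp_rec _ _ (fun o x _ a => St o x a) hB hS' hN) => o x.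
by elim: (N o x) => //= n ->.
Qed.

(* Constants are opaque so that [cpair] is not matched as a sum. *)
Create HintDb cmp.
#[global] Hint Constants Opaque : cmp.
#[global] Hint Resolve cmp_id cmp_const : cmp.
#[global] Hint Resolve cmp_pf cmp_ps cmp_pair cmp_succ cmp_orc cmp_iter cmp_rec : cmp.

Section Arith.
Variables (F G : (nat -> nat -> nat) -> nat -> nat).
Hypotheses (hF : cmp F) (hG : cmp G).

Lemma cmp_pred : cmp (fun o x => (F o x).-1).
Proof.
apply: (cmp_comp (F := fun _ x => x.-1)) hF.
apply: (@cmp_ext (fun _ x => nat_rect _ 0 (fun i _ => i) x)) => [o []//|].
by auto with cmp.
Qed.

Lemma cmp_add : cmp (fun o x => F o x + G o x).
Proof.
apply: (cmp_comp2 (F := fun _ => addn)) hF hG.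
apply: (@cmp_ext (fun _ z => iter (pf z) S (ps z))); last by auto with cmp.
by move=> _ x; elim: (pf x) => //= n ->.
Qed.
End Arith.
#[global] Hint Resolve cmp_pred cmp_add : cmp.

Section Arith2.
Variables (F G : (nat -> nat -> nat) -> nat -> nat).
Hypotheses (hF : cmp F) (hG : cmp G).

Lemma cmp_sub : cmp (fun o x => F o x - G o x).
Proof.
apply: (cmp_comp2 (F := fun _ => subn)) hF hG.
apply: (@cmp_ext (fun _ z => iter (ps z) predn (pf z))); last by auto with cmp.
by move=> _ x; elim: (ps x) => [|n /= ->]; rewrite ?subn0 // subnS.
Qed.

Lemma cmp_mul : cmp (fun o x => F o x * G o x).
Proof.
apply: (cmp_comp2 (F := fun _ => muln)) hF hG.
apply: (@cmp_ext (fun _ z => iter (pf z) (addn (ps z)) 0)); last by auto 9 with cmp.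
by move=> _ x; elim: (pf x) => //= n ->; rewrite mulSn.
Qed.
End Arith2.
#[global] Hint Resolve cmp_sub cmp_mul : cmp.

Section Arith3.
Variables (F G : (nat -> nat -> nat) -> nat -> nat).
Hypotheses (hF : cmp F) (hG : cmp G).

Lemma cmp_exp : cmp (fun o x => F o x ^ G o x).
Proof.
apply: (cmp_comp2 (F := fun _ => expn)) hF hG.
apply: (@cmp_ext (fun _ z => iter (ps z) (muln (pf z)) 1)); last by auto 9 with cmp.
by move=> _ x; elim: (ps x) => //= n ->; rewrite expnS.
Qed.

Lemma cmp_leq : cmp (fun o x => nat_of_bool (F o x <= G o x)).
Proof.
apply: (@cmp_ext (fun o z => 1 - (F o z - G o z))); last by auto with cmp.
by move=> o z /=; case: leqP; lia.
Qed.
End Arith3.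
#[global] Hint Resolve cmp_exp cmp_leq : cmp.

Section Bool.
Variables (P Q : (nat -> nat -> nat) -> nat -> bool).
Variables (F G : (nat -> nat -> nat) -> nat -> nat).
Hypotheses (hP : cmp (fun o x => P o x)) (hQ : cmp (fun o x => Q o x)).
Hypotheses (hF : cmp F) (hG : cmp G).

Lemma cmp_and : cmp (fun o x => nat_of_bool (P o x && Q o x)).
Proof.
apply: (@cmp_ext (fun o z => P o z * Q o z)); last by auto with cmp.
by move=> o z; rewrite mulnb.
Qed.

Lemma cmp_neg : cmp (fun o x => nat_of_bool (~~ P o x)).
Proof.
apply: (@cmp_ext (fun o z => 1 - P o z)); last by auto with cmp.
by move=> o z; case: (P o z).
Qed.

Lemma cmp_if : cmp (fun o x => if P o x then F o x else G o x).
Proof.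
apply: (@cmp_ext (fun o z => P o z * F o z + (1 - P o z) * G o z));
  last by auto with cmp.
by move=> o z; case: (P o z); lia.
Qed.

Lemma cmp_eqn : cmp (fun o x => nat_of_bool (F o x == G o x)).
Proof.
apply: (@cmp_ext (fun o z => (F o z <= G o z) * (G o z <= F o z))).
  by move=> o z; rewrite mulnb eqn_leq.
by auto with cmp.
Qed.
End Bool.
#[global] Hint Resolve cmp_and cmp_neg cmp_if cmp_eqn : cmp.

Lemma cmp_or (P Q : (nat -> nat -> nat) -> nat -> bool) :
  cmp (fun o x => P o x) -> cmp (fun o x => Q o x) ->
  cmp (fun o x => nat_of_bool (P o x || Q o x)).
Proof.
move=> hP hQ.
apply: (@cmp_ext (fun o z => nat_of_bool (~~ (~~ P o z && ~~ Q o z)))).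
  by move=> o z; rewrite negb_and !negbK.
by auto with cmp.
Qed.
#[global] Hint Resolve cmp_or : cmp.

Lemma cmp_odd F : cmp F -> cmp (fun o x => nat_of_bool (odd (F o x))).
Proof.
apply: (cmp_comp (F := fun _ x => odd x)).
apply: (@cmp_ext (fun _ x => iter x (subn 1) 0)); last by auto with cmp.
by move=> _; elim=> //= n ->; case: odd.
Qed.
#[global] Hint Resolve cmp_odd : cmp.

Lemma cmp_half F : cmp F -> cmp (fun o x => (F o x)./2).
Proof.
apply: (cmp_comp (F := fun _ x => x./2)).
apply: (@cmp_ext (fun _ x => nat_rect _ 0 (fun i a => odd i + a) x));
  last by auto with cmp.
by move=> _; elim=> //= n ->; rewrite uphalf_half.
Qed.
#[global] Hint Resolve cmp_half : cmp.

(** * Lists of numbers coded as numbers *)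

(** The successor keeps 0 free for the empty list. *)
Definition lcons a l := (cpair a l).+1.
Definition lhd l := pf l.-1.
Definition ltl l := ps l.-1.
Definition lcode (l : seq nat) : nat := foldr lcons 0 l.

Lemma lhdE a l : lhd (lcons a l) = a. Proof. exact: pfE. Qed.
Lemma ltlE a l : ltl (lcons a l) = l. Proof. exact: psE. Qed.
Lemma lcons_eq0 a l : (lcons a l == 0) = false. Proof. by []. Qed.
Definition llE := (lhdE, ltlE, lcons_eq0).

Lemma cmp_lcons F G : cmp F -> cmp G -> cmp (fun o x => lcons (F o x) (G o x)).
Proof. by rewrite /lcons; auto with cmp. Qed.
Lemma cmp_lhd F : cmp F -> cmp (fun o x => lhd (F o x)).
Proof. by rewrite /lhd; auto with cmp. Qed.
Lemma cmp_ltl F : cmp F -> cmp (fun o x => ltl (F o x)).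
Proof. by rewrite /ltl; auto with cmp. Qed.
#[global] Hint Resolve cmp_lcons cmp_lhd cmp_ltl : cmp.

(** The state pairs the unread rest of the list with the accumulator and is fixed once the rest is
    empty. So [lfold] may iterate as often as the code says, which is at least the length of the
    list. *)
Definition lfold_step (F : nat -> nat -> nat) s :=
  if pf s == 0 then s else cpair (ltl (pf s)) (F (lhd (pf s)) (ps s)).
Definition lfold F l z := ps (iter l (lfold_step F) (cpair l z)).

Lemma size_lcode l : size l <= lcode l.
Proof.
elim: l => //= a l IH; apply: leq_ltn_trans IH _; exact: ps_lt_cpairS.
Qed.

Lemma lfoldE F l z : lfold F (lcode l) z = foldl (fun acc a => F a acc) z l.
Proof.
move: (size_lcode l); rewrite /lfold; move: {1 2}(lcode l) => N.
elim: N l z => [|N IH] [|a l] z //=.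
- by rewrite pE.
- rewrite -iterS iterSr /lfold_step pE /= => _; exact: (IH [::]).
- by move=> /IH {}IH; rewrite -iterS iterSr /lfold_step !pE !llE IH.
Qed.

Lemma cmp_lfold F G H : cmp (fun _ z => F (pf z) (ps z)) -> cmp G -> cmp H ->
  cmp (fun o x => lfold F (G o x) (H o x)).
Proof.
move=> hF; apply: (cmp_comp2 (F := fun _ => lfold F)).
have h G' H' : cmp G' -> cmp H' -> cmp (fun o x => F (G' o x) (H' o x)).
  exact: (cmp_comp2 (F := fun _ => F)).
rewrite /lfold /lfold_step; apply: cmp_ps; apply: cmp_iter; auto 20 with cmp.
Qed.
#[global] Hint Extern 1 (cmp (fun _ _ => lfold _ _ _)) => apply: cmp_lfold : cmp.

Definition lrev l := lfold lcons l 0.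
Lemma lrevE l : lrev (lcode l) = lcode (rev l).
Proof.
rewrite /lrev lfoldE -[l in RHS]revK.
by rewrite -[l in LHS]revK foldl_rev revK.
Qed.
Lemma cmp_lrev F : cmp F -> cmp (fun o x => lrev (F o x)).
Proof. by move=> hF; rewrite /lrev; auto with cmp. Qed.
#[global] Hint Resolve cmp_lrev : cmp.

(** * A small-step machine for terms *)

(** Supplies induction hypotheses also for the evaluations nested under the existential in
    [evMu]. *)
Lemma ev_ind_nested (o : nat -> nat -> nat) (P : term -> nat -> nat -> Prop) :
  (forall x, P TZero x 0) ->
  (forall x, P TSucc x x.+1) ->
  (forall x, P TFst x (pf x)) ->
  (forall x, P TSnd x (ps x)) ->
  (forall f g x a b, P f x a -> P g x b -> P (TPair f g) x (cpair a b)) ->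
  (forall f g x y z, P g x y -> P f y z -> P (TComp f g) x z) ->
  (forall f g x y, P f x y -> P (TRec f g) (cpair 0 x) y) ->
  (forall f g n x y z, P (TRec f g) (cpair n x) y ->
     P g (cpair n (cpair y x)) z -> P (TRec f g) (cpair n.+1 x) z) ->
  (forall f x n, P f (cpair n x) 0 ->
     (forall m, m < n -> exists v, v <> 0 /\ P f (cpair m x) v) ->
     P (TMu f) x n) ->
  (forall j x, P (TOrc j) x (o j x)) ->
  forall t x y, ev o t x y -> P t x y.
Proof.
move=> p0 pS pF pSn pP pC pR0 pRS pM pO; fix IH 4 => t x y [] {t x y} //.
- by move=> f g x a b /IH ha /IH hb; apply: pP.
- by move=> f g x y z /IH ha /IH; apply: pC ha.
- by move=> f g x y /IH; apply: pR0.
- by move=> f g n x y z /IH ha /IH; apply: pRS ha.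
- move=> f x n /IH h0 hm; apply: pM h0 _ => m /hm [v [v0 /IH hv]].
  by exists v.
Qed.

(** A frame says what to do with the value about to be returned. [KPair2] keeps the first component;
    [KRec g i n x] awaits stage [i] of a recursion up to [n]; [KMu f n x] awaits the test of
    candidate [n]. *)
Inductive frame : Type :=
| KPair1 of term & nat
| KPair2 of nat
| KComp of term
| KRec of term & nat & nat & nat
| KMu of term & nat & nat.

Inductive state : Type :=
| Ev of term & nat & seq frame
| Rt of nat & seq frame.

(** Oracle calls return 0, as [noorc] prescribes. A final state [Rt y [::]] is a fixed point, so
    running longer does no harm. *)
Definition step (s : state) : state :=
  match s with
  | Ev TZero x K => Rt 0 K
  | Ev TSucc x K => Rt x.+1 K
  | Ev TFst x K => Rt (pf x) K
  | Ev TSnd x K => Rt (ps x) K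
  | Ev (TPair f g) x K => Ev f x (KPair1 g x :: K)
  | Ev (TComp f g) x K => Ev g x (KComp f :: K)
  | Ev (TRec f g) x K => Ev f (ps x) (KRec g 0 (pf x) (ps x) :: K)
  | Ev (TMu f) x K => Ev f (cpair 0 x) (KMu f 0 x :: K)
  | Ev (TOrc _) x K => Rt 0 K
  | Rt y [::] => s
  | Rt y (KPair1 g x :: K) => Ev g x (KPair2 y :: K)
  | Rt y (KPair2 a :: K) => Rt (cpair a y) K
  | Rt y (KComp f :: K) => Ev f y K
  | Rt y (KRec g i n x :: K) =>
      if i == n then Rt y K
      else Ev g (cpair i (cpair y x)) (KRec g i.+1 n x :: K)
  | Rt y (KMu f n x :: K) =>
      if y == 0 then Rt n K
      else Ev f (cpair n.+1 x) (KMu f n.+1 x :: K)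
  end.

(* The value [z] is what the stack [K] turns [y] into; the clauses for
   recursion and minimisation take the part of the loop already executed as a
   hypothesis, so that the frame does not have to record it. *)
Fixpoint returns (K : seq frame) (y z : nat) : Prop :=
  match K with
  | [::] => y = z
  | KPair1 g x :: K => exists2 b, ev noorc g x b & returns K (cpair y b) z
  | KPair2 a :: K => returns K (cpair a y) z
  | KComp f :: K => exists2 w, ev noorc f y w & returns K w z
  | KRec g i n x :: K => exists2 w,
      (forall f, ev noorc (TRec f g) (cpair i x) y ->
                 ev noorc (TRec f g) (cpair n x) w) & returns K w z
  | KMu f n x :: K => exists2 w,
      ((forall m, m < n -> exists v, v <> 0 /\ ev noorc f (cpair m x) v) ->
       ev noorc f (cpair n x) y -> ev noorc (TMu f) x w) & returns K w z
  end.

Definition yields (s : state) (z : nat) : Prop :=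
  match s with
  | Ev t x K => exists2 y, ev noorc t x y & returns K y z
  | Rt y K => returns K y z
  end.

(** Soundness, read backwards: the meaning of a state is inherited from its successor, so a halted
    run certifies the evaluation it started from. *)
Lemma yields_step s z : yields (step s) z -> yields s z.
Proof.
case: s => [[||||f g|f g|f g|f|j] x K|y [|[g x|a|f|g i n x|f n x] K]] //=.
- by exists 0 => //; constructor.
- by exists x.+1 => //; constructor.
- by exists (pf x) => //; constructor.
- by exists (ps x) => //; constructor.
- by case=> a ha [b hb hK]; exists (cpair a b) => //; constructor.
- by case=> a ha [b hb hK]; exists b => //; econstructor; eauto.
- case=> a ha [w hw hK]; exists w => //; rewrite -(cpair_pfps x).
  by apply: hw; constructor.
- by case=> a ha [w hw hK]; exists w => //; apply: hw.
- by exists 0 => //; apply: (evOrc noorc).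
- case: eqP => [-> hK|_ [v hv [w hw hK]]]; first by exists y.
  by exists w => // f hf; apply: hw; apply: evRecS hf hv.
- case: eqP => [-> hK|y0 [v hv [w hw hK]]].
    by exists n => // hm h0; constructor.
  exists w => // hm h0; apply: hw => // m; rewrite ltnS leq_eqVlt.
  by case/orP => [/eqP ->|/hm //]; exists y.
Qed.

Definition reach s s' := exists n, iter n step s = s'.

Lemma reach_refl s : reach s s. Proof. by exists 0. Qed.
Lemma reach_trans s1 s2 s3 : reach s1 s2 -> reach s2 s3 -> reach s1 s3.
Proof. by move=> [n <-] [m <-]; exists (m + n); rewrite iterD. Qed.
Lemma reach_step s s' : reach (step s) s' -> reach s s'.
Proof. by move=> [n <-]; exists n.+1; rewrite iterSr. Qed.

Lemma ev_reach t x y : ev noorc t x y -> forall K, reach (Ev t x K) (Rt y K).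
Proof.
move=> h K; suff [] : (forall K, reach (Ev t x K) (Rt y K)) /\
  (* A derivation for [TRec] climbs from 0 without knowing the final bound held in the frame. Hence
     the stronger claim that reaching stage [pf x] is an initial segment of the loop for any bound
     [N] not below it. *)
  (if t is TRec f g then forall N K, pf x <= N ->
    reach (Ev f (ps x) (KRec g 0 N (ps x) :: K))
          (Rt y (KRec g (pf x) N (ps x) :: K)) else True) by [].
move: t x y h {K}; apply: ev_ind_nested; try by split=> // K; exists 1.
- move=> f g x a b [ha _] [hb _]; split=> // K.
  apply: reach_step => /=; apply: reach_trans (ha _) _.
  by apply: reach_step => /=; apply: reach_trans (hb _) _; exists 1.
- move=> f g x y z [ha _] [hb _]; split=> // K.
  by apply: reach_step => /=; apply: reach_trans (ha _) _; apply: reach_step => /=; apply: hb.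
- move=> f g x y [ha _]; split=> [K|N K _]; last by rewrite !pE; apply: ha.
  apply: reach_step; rewrite /= !pE; apply: reach_trans (ha _) _.
  by apply: reach_step; apply: reach_refl.
- move=> f g n x y z [_ ha] [hb _].
  have loop N K : n < N -> reach (Ev f x (KRec g 0 N x :: K))
                       (Rt z (KRec g n.+1 N x :: K)).
    move=> ltnN; have := ha N K; rewrite !pE => /(_ (ltnW ltnN)) /reach_trans.
    by apply; apply: reach_step; rewrite /= ltn_eqF //; apply: hb.
  split=> [K|N K]; rewrite ?pE; last exact: loop.
  apply: reach_step => /=; rewrite !pE.
  apply: reach_trans (loop n.+1 K (ltnSn n)) _.
  by apply: reach_step; rewrite /= eqxx; apply: reach_refl.
- move=> f x n [h0 _] hm; split=> // K.
  have loop m : m <= n ->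
      reach (Ev f (cpair 0 x) (KMu f 0 x :: K)) (Ev f (cpair m x) (KMu f m x :: K)).
    elim: m => [_|m IH lt_mn]; first exact: reach_refl.
    apply: reach_trans (IH (ltnW lt_mn)) _.
    have [v [/eqP/negbTE v0 [hv _]]] := hm _ lt_mn.
    apply: reach_trans (hv _) _; apply: reach_step; rewrite /= v0.
    exact: reach_refl.
  apply: reach_step => /=; apply: reach_trans (loop n (leqnn n)) _.
  by apply: reach_trans (h0 _) _; exists 1.
Qed.

(** The machine is deterministic and final states are fixed, so two halting runs agree after the sum
    of their lengths. *)
Lemma ev_functional t x y z : ev noorc t x y -> ev noorc t x z -> y = z.
Proof.
move=> /ev_reach/(_ [::]) [n hn] /ev_reach/(_ [::]) [m hm].
have fixed k w : iter k step (Rt w [::]) = Rt w [::] by rewrite iter_fix.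
have : iter (m + n) step (Ev t x [::]) = iter (n + m) step (Ev t x [::]).
  by rewrite addnC.
by rewrite !iterD hn hm !fixed => -[].
Qed.

Lemma iter_step_ev n t x y :
  iter n step (Ev t x [::]) = Rt y [::] -> ev noorc t x y.
Proof.
move=> E; suff [w hw <- //] : yields (Ev t x [::]) y.
have : yields (iter n step (Ev t x [::])) y by rewrite E.
by elim: {E}n (Ev _ _ _) => //= n IH s /yields_step/IH.
Qed.

(** * The machine acting on numerical codes *)

(** The tags are the node labels of [enc], so a label parsed from an index serves directly as
    operation code. *)
Fixpoint tcode (t : term) : nat :=
  match t with
  | TZero => cpair 0 0
  | TSucc => cpair 1 0
  | TFst => cpair 2 0
  | TSnd => cpair 3 0
  | TPair f g => cpair 4 (cpair (tcode f) (tcode g))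
  | TComp f g => cpair 5 (cpair (tcode f) (tcode g))
  | TRec f g => cpair 6 (cpair (tcode f) (tcode g))
  | TMu f => cpair 7 (tcode f)
  | TOrc _ => cpair 0 0
  end.

Definition fcode (k : frame) : nat :=
  match k with
  | KPair1 g x => cpair 0 (cpair (tcode g) x)
  | KPair2 a => cpair 1 a
  | KComp f => cpair 2 (tcode f)
  | KRec g i n x => cpair 3 (cpair (tcode g) (cpair i (cpair n x)))
  | KMu f n x => cpair 4 (cpair (tcode f) (cpair n x))
  end.

Definition rt y K := cpair 0 (cpair y K).
Definition ec t x K := cpair 1 (cpair t (cpair x K)).
Definition scode (s : state) : nat :=
  match s with
  | Rt y K => rt y (lcode (map fcode K))
  | Ev t x K => ec (tcode t) x (lcode (map fcode K))
  end.

Definition nstep_ev (op arg x K : nat) : nat :=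
  if op == 0 then rt 0 K
  else if op == 1 then rt x.+1 K
  else if op == 2 then rt (pf x) K
  else if op == 3 then rt (ps x) K
  else if op == 4 then
    ec (pf arg) x (lcons (cpair 0 (cpair (ps arg) x)) K)
  else if op == 5 then ec (ps arg) x (lcons (cpair 2 (pf arg)) K)
  else if op == 6 then
    ec (pf arg) (ps x)
       (lcons (cpair 3 (cpair (ps arg) (cpair 0 (cpair (pf x) (ps x))))) K)
  else ec arg (cpair 0 x) (lcons (cpair 4 (cpair arg (cpair 0 x))) K).

Definition nstep_rt (op arg y K : nat) : nat :=
  if op == 0 then ec (pf arg) (ps arg) (lcons (cpair 1 y) K)
  else if op == 1 then rt (cpair arg y) K
  else if op == 2 then ec arg y K
  else if op == 3 then
    if pf (ps arg) == pf (ps (ps arg)) then rt y K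
    else ec (pf arg) (cpair (pf (ps arg)) (cpair y (ps (ps (ps arg)))))
       (lcons (cpair 3 (cpair (pf arg) (cpair (pf (ps arg)).+1 (ps (ps arg))))) K)
  else
    if y == 0 then rt (pf (ps arg)) K
    else ec (pf arg) (cpair (pf (ps arg)).+1 (ps (ps arg)))
       (lcons (cpair 4 (cpair (pf arg) (cpair (pf (ps arg)).+1 (ps (ps arg))))) K).

Definition nstep (s : nat) : nat :=
  if pf s == 1 then
    nstep_ev (pf (pf (ps s))) (ps (pf (ps s))) (pf (ps (ps s))) (ps (ps (ps s)))
  else if ps (ps s) == 0 then s
  else nstep_rt (pf (lhd (ps (ps s)))) (ps (lhd (ps (ps s)))) (pf (ps s))
                (ltl (ps (ps s))).

Lemma nstepE s : nstep (scode s) = scode (step s).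
Proof.
case: s => [[||||f g|f g|f g|f|j] x K|y [|[g x|a|f|g i n x|f n x] K]];
  cbn [step scode tcode fcode map lcode foldr];
  rewrite /nstep /nstep_ev /nstep_rt /rt /ec !pE ?llE ?pE //.
- by case: (i == n).
- by case: (y == 0).
Qed.

Lemma cmp_nstep F : cmp F -> cmp (fun o x => nstep (F o x)).
Proof.
apply: (cmp_comp (F := fun _ x => nstep x)).
by rewrite /nstep /nstep_ev /nstep_rt /rt /ec; auto 50 with cmp.
Qed.
#[global] Hint Resolve cmp_nstep : cmp.

(** * Decoding indices *)

(* In the binary expansion of [CodeSeq.code], read from the low end, an entry
   [a] is a run of [a] zeros closed by a one; [rdec] collects the entries in
   reverse order. *)
Definition bit_step v q acc :=
  if q == 0 then cpair v (cpair q acc)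
  else if odd q then cpair 0 (cpair q./2 (lcons v acc))
  else cpair v.+1 (cpair q./2 acc).
Definition bits_step s := bit_step (pf s) (pf (ps s)) (ps (ps s)).
Definition rdec n := ps (ps (iter n bits_step (cpair 0 (cpair n 0)))).

Lemma cmp_rdec F : cmp F -> cmp (fun o x => rdec (F o x)).
Proof.
apply: (cmp_comp (F := fun _ x => rdec x)).
by rewrite /rdec /bits_step /bit_step; auto 50 with cmp.
Qed.
#[global] Hint Resolve cmp_rdec : cmp.

Lemma iter_bits_done n v acc :
  iter n bits_step (cpair v (cpair 0 acc)) = cpair v (cpair 0 acc).
Proof. by rewrite iter_fix // /bits_step /bit_step !pE. Qed.

(** [2 ^ a * m.*2.+1] is the code of a list with head [a] whose tail has code [m]: [a] zeros and the
    closing one take [a.+1] steps. *)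
Lemma iter_bits_item a m v acc :
  iter a.+1 bits_step (cpair v (cpair (2 ^ a * m.*2.+1) acc)) =
  cpair 0 (cpair m (lcons (v + a) acc)).
Proof.
elim: a v => [|a IH] v.
  rewrite /= /bits_step /bit_step !pE expn0 mul1n /= odd_double addn0.
  by rewrite uphalf_double.
have -> : iter a.+2 bits_step (cpair v (cpair (2 ^ a.+1 * m.*2.+1) acc)) =
    iter a.+1 bits_step (cpair v.+1 (cpair (2 ^ a * m.*2.+1) acc)).
  rewrite iterSr; congr (iter _ _ _); rewrite /bits_step /bit_step !pE.
  by rewrite expnS -mulnA mul2n double_eq0 muln_eq0 expn_eq0 odd_double doubleK.
by rewrite IH addSnnS.
Qed.

Lemma iter_bits_code l N acc : CodeSeq.code l <= N ->
  iter N bits_step (cpair 0 (cpair (CodeSeq.code l) (lcode acc))) =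
  cpair 0 (cpair 0 (lcode (catrev l acc))).
Proof.
elim: l N acc => [|a l IH] N acc /=; first by rewrite iter_bits_done.
set c := CodeSeq.code l in IH * => le_N.
(* The step budget: [a.+1 + c <= 2 ^ a * c.*2.+1], so the value of the code bounds the number of its
   bits to be read. *)
have aN : a.+1 + c <= N.
  by apply: leq_trans le_N; have := ltn_expl a (ltnSn 1); nia.
rewrite -(subnK (leq_trans (leq_addr c _) aN)) iterD iter_bits_item add0n.
by apply: (IH _ (a :: acc)); lia.
Qed.

Lemma rdecE n : rdec n = lcode (rev (CodeSeq.decode n)).
Proof.
rewrite /rdec; have := @iter_bits_code (CodeSeq.decode n) n [::].
by rewrite CodeSeq.decodeK => -> //; rewrite !pE.
Qed.

Definition ndec n := lrev (rdec n).
Lemma ndecE n : ndec n = lcode (CodeSeq.decode n).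
Proof. by rewrite /ndec rdecE lrevE revK. Qed.
Lemma cmp_ndec F : cmp F -> cmp (fun o x => ndec (F o x)).
Proof. by move=> hF; rewrite /ndec; auto with cmp. Qed.
#[global] Hint Resolve cmp_ndec : cmp.

Definition ocode (c : option (nat + nat)) : nat :=
  match c with
  | None => 0
  | Some (inl x) => (cpair 0 x).+1
  | Some (inr y) => (cpair 1 y).+1
  end.

(** A sum is pickled as a pair of options, an option as a list of at most one entry. On codes with
    both entries present the second wins, as in [sum_of_opair]. *)
Definition nsum2 a b :=
  if b != 0 then (cpair 1 (lhd b)).+1
  else if a != 0 then (cpair 0 (lhd a)).+1 else 0.
Definition nsum_list l :=
  if (l != 0) && (ltl l != 0) && (ltl (ltl l) == 0) then
    nsum2 (ndec (lhd l)) (ndec (lhd (ltl l)))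
  else 0.
Definition nsum n := nsum_list (ndec n).

Lemma nsumE n : nsum n = ocode (unpickle n).
Proof.
rewrite /nsum ndecE /nsum_list.
have -> : unpickle n = obind sum_of_opair (obind (fun y => Some (pair_of_tag y))
  (unpickle_tagged
          (I:=Datatypes_option__canonical__choice_Countable
                Datatypes_nat__canonical__choice_Countable)
          (fun=> Datatypes_option__canonical__choice_Countable
                   Datatypes_nat__canonical__choice_Countable)
          n)) by [].
rewrite /unpickle_tagged.
case: (CodeSeq.decode n) => [|a [|b [|c l]]] //=; rewrite ?llE //.
rewrite /unpickle /= /pcomp /= /nsum2 !ndecE /pair_of_tag /=.
by case: (CodeSeq.decode b) => [|y l] /=; case: (CodeSeq.decode a) => [|x l'] /=;
  rewrite ?llE.
Qed.

Lemma cmp_nsum F : cmp F -> cmp (fun o x => nsum (F o x)).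
Proof.
apply: (cmp_comp (F := fun _ x => nsum x)).
by rewrite /nsum /nsum_list /nsum2; auto 50 with cmp.
Qed.
#[global] Hint Resolve cmp_nsum : cmp.

(* [cpair 0 0] codes [TZero], the value of [dec] on ill-formed nodes, and also
   oracle calls, which [noorc] answers by 0. *)
Definition mknode op l : nat :=
  if op <= 3 then cpair op 0
  else if (op <= 6) && (l != 0) && (ltl l != 0) && (ltl (ltl l) == 0) then
    cpair op (cpair (lhd l) (lhd (ltl l)))
  else if (op == 7) && (l != 0) && (ltl l == 0) then cpair 7 (lhd l)
  else cpair 0 0.

Lemma mknodeE op ts : mknode op (lcode (map (tcode \o dec) ts)) =
  tcode (dec (GenTree.Node op ts)).
Proof.
case: op => [|[|[|[|[|[|[|[|op]]]]]]]] //;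
  by case: ts => [|a [|b [|c ts]]]; rewrite /mknode /= ?llE.
Qed.

(** Mirrors [GenTree.decode_step], each subtree being replaced at once by the code of its term;
    [fs1] is the current forest and [fs2] the stack of suspended ones. An entry that fails to
    unpickle is skipped. *)
Definition parse_step n fs1 fs2 : nat :=
  if n == 0 then cpair fs1 fs2
  else if pf n.-1 == 1 then cpair (lcons (cpair 0 0) fs1) fs2
  else if ps n.-1 == 0 then cpair 0 (lcons fs1 fs2)
  else cpair (lcons (mknode (ps n.-1).-1 fs1) (lhd fs2)) (ltl fs2).
Definition parse_item n s := parse_step (nsum n) (pf s) (ps s).

Definition forest (ts : seq (GenTree.tree nat)) : nat :=
  lcode (map (tcode \o dec) ts).
Definition pstate fs : nat := cpair (forest fs.1) (lcode (map forest fs.2)).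

Lemma parse_itemE n fs : parse_item n (pstate fs) =
  pstate (oapp (fun c => @GenTree.decode_step nat c fs) fs (unpickle n)).
Proof.
rewrite /parse_item nsumE /pstate /parse_step !pE.
case: (unpickle n) => [[[|op]|j]|] //=.
- by rewrite !pE /= mknodeE; case: fs.2 => [|f fs2] //=; rewrite !llE.
- by rewrite !pE.
Qed.

(** [GenTree.decode] folds from the right, hence the left fold over the reversed list [rdec e]. *)
Definition parse (e : nat) : nat :=
  let fs := pf (lfold parse_item (rdec e) (cpair 0 0)) in
  if fs == 0 then cpair 0 0 else lhd fs.

Lemma parseE e : parse e = tcode (alg e).
Proof.
rewrite /parse rdecE lfoldE foldl_rev.
set l := CodeSeq.decode e.
have -> : foldr parse_item (cpair 0 0) l =
   pstate (foldr (@GenTree.decode_step nat) ([::], [::]) (pmap unpickle l)).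
  elim: l => [|a l IH] //=; rewrite IH parse_itemE.
  by case: (unpickle a).
have -> : alg e = if GenTree.decode (pmap unpickle l) is Some t then dec t else TZero.
  by [].
rewrite /GenTree.decode /pstate !pE.
by case: (foldr _ _ _).1 => [|t ts] //=; rewrite llE.
Qed.

Lemma cmp_parse F : cmp F -> cmp (fun o x => parse (F o x)).
Proof.
apply: (cmp_comp (F := fun _ x => parse x)).
have h : cmp (fun _ z => parse_item (pf z) (ps z)).
  by rewrite /parse_item /parse_step /mknode; auto 50 with cmp.
by rewrite /parse /=; auto 50 with cmp.
Qed.
#[global] Hint Resolve cmp_parse : cmp.

(** * Step-bounded runs of an index *)

Definition halted s := (pf s == 0) && (ps (ps s) == 0).
Definition nresult s := pf (ps s).
Definition nrun e x n := iter n nstep (ec (parse e) x 0).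

Lemma nrunE e x n : nrun e x n = scode (iter n step (Ev (alg e) x [::])).
Proof.
rewrite /nrun parseE; have -> : ec (tcode (alg e)) x 0 = scode (Ev (alg e) x [::]).
  by [].
by elim: n => //= n ->; rewrite nstepE.
Qed.

Lemma halted_scode s : halted (scode s) -> s = Rt (nresult (scode s)) [::].
Proof.
by rewrite /halted /nresult; case: s => [t x K|y [|f K]] /=; rewrite /rt /ec !pE.
Qed.

Lemma nrun_sound e x n : halted (nrun e x n) -> runs e x (nresult (nrun e x n)).
Proof. by rewrite nrunE => /halted_scode /iter_step_ev. Qed.

Lemma nrun_complete e x y : runs e x y -> exists N, forall n, N <= n ->
  halted (nrun e x n) /\ nresult (nrun e x n) = y.
Proof.
move=> /ev_reach/(_ [::]) [N hN]; exists N => n le_Nn.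
rewrite nrunE -(subnK le_Nn) iterD hN iter_fix //= /halted /nresult /rt.
by rewrite !pE.
Qed.

Lemma cmp_nrun F G H : cmp F -> cmp G -> cmp H ->
  cmp (fun o x => nrun (F o x) (G o x) (H o x)).
Proof.
apply: (cmp_comp3 (F := fun _ => nrun)).
by rewrite /nrun /ec; auto 50 with cmp.
Qed.

Lemma cmp_halted F : cmp F -> cmp (fun o x => halted (F o x)).
Proof. by rewrite /halted; auto 50 with cmp. Qed.
Lemma cmp_nresult F : cmp F -> cmp (fun o x => nresult (F o x)).
Proof. by rewrite /nresult; auto 50 with cmp. Qed.
#[global] Hint Resolve cmp_nrun cmp_halted cmp_nresult : cmp.

(** * Searching in the limit *)

(** A bare [nat_rect] over numbers, so that [cmp_rec] shows it computable. *)
Definition bexists (P : nat -> bool) n : bool :=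
  nat_rect (fun _ => nat) 0 (fun s acc => P s || (acc != 0)) n != 0.

Lemma bexistsP (P : nat -> bool) n : reflect (exists2 s, s < n & P s) (bexists P n).
Proof.
apply: (iffP idP); rewrite /bexists.
  elim: n => //= n IH; case: (boolP (P n)) => [Pn _|_ /=]; first by exists n.
  by rewrite eqb0 negbK => /IH [s lt_sn Ps]; exists s => //; apply: ltnW.
case=> s; elim: n => //= n IH; rewrite ltnS leq_eqVlt => /orP [/eqP -> ->//|lt_sn Ps].
by rewrite (IH lt_sn Ps) orbT.
Qed.

(** The accumulator stores the witness plus one, 0 meaning that none is found yet; without a witness
    the result defaults to 0. *)
Definition bleast (P : nat -> bool) n : nat :=
  (nat_rect (fun _ => nat) 0
     (fun i acc => if acc != 0 then acc else if P i then i.+1 else 0) n).-1.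

Lemma bleastE (P : nat -> bool) n j : j < n -> P j -> (forall i, i < j -> ~~ P i) ->
  bleast P n = j.
Proof.
move=> lt_jn Pj Pmin; rewrite /bleast; set f := nat_rect _ _ _.
have f0 i : i <= j -> f i = 0.
  elim: i => //= i IH lt_ij.
  by rewrite -/(f i) (IH (ltnW lt_ij)) /= (negbTE (Pmin _ lt_ij)).
suff -> : f n = j.+1 by [].
elim: n lt_jn => // n IH; rewrite ltnS leq_eqVlt => /orP [/eqP <-|/IH] /=.
  by rewrite -/(f j) f0 //= Pj.
by rewrite -/(f n) => ->.
Qed.

Definition full_oracle (g x : nat -> nat) : nat -> nat -> nat :=
  fun j m => if j == 0 then g m else x m.

(* A limiting search: among the candidates [j] guess [E o j] for the least one
   that no test [s < n] rejects. *)
Lemma limit_learner (U : nat) (E : (nat -> nat -> nat) -> nat -> nat)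
    (T : (nat -> nat -> nat) -> nat -> nat -> bool) :
  cmp E -> cmp (fun o z => T o (pf z) (ps z)) ->
  (forall g x n j, E (learner_oracles g x n) j = E (full_oracle g x) j) ->
  (forall g x n j s, s < n ->
     T (learner_oracles g x n) j s = T (full_oracle g x) j s) ->
  exists A, forall L S g x,
    (exists j, forall s, ~~ T (full_oracle g x) j s) ->
    (forall j, (forall s, ~~ T (full_oracle g x) j s) ->
       S (E (full_oracle g x) j) /\
       typical_for_alg L U (E (full_oracle g x) j) x) ->
    identifies L U S A g x.
Proof.
move=> hE hT locE locT.
have [A hA] : cmp (fun o n => E o (bleast (fun j => ~~ bexists (T o j) n) n)).
  have h F G : cmp F -> cmp G -> cmp (fun o x => T o (F o x) (G o x)).
    exact: (cmp_comp2 (F := fun o x y => nat_of_bool (T o x y))).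
  apply: (cmp_comp hE); rewrite /bleast /bexists; auto 50 with cmp.
exists A => L S g x [j1 hj1] sound; set o := full_oracle g x in hj1 sound *.
split; first by move=> n; eexists; apply: hA.
(* Rejection is only semi-decidable, so the least candidate never rejected is obtained
   classically. *)
have [j0 [hj0 min_j0]] : exists j, (forall s, ~~ T o j s) /\
    (forall i, i < j -> exists s, T o i s).
  elim/ltn_ind: j1 hj1 => j IH hj.
  have [[i [lt_ij hi]]|no_i] :=
    classic (exists i, i < j /\ forall s, ~~ T o i s); first exact: IH hi.
  exists j; split=> // i lt_ij; apply: NNPP => no_s; apply: no_i.
  by exists i; split=> // s; apply/negP => Ts; apply: no_s; exists s.
have [N hN] : exists N, forall i, i < j0 -> exists2 s, s < N & T o i s.
  elim: {hj0}j0 min_j0 => [|j IH] min_j; first by exists 0.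
  have [N hN] := IH (fun i lt_ij => min_j i (ltnW lt_ij)).
  have [s Ts] := min_j j (ltnSn j); exists (maxn N s.+1) => i.
  rewrite ltnS leq_eqVlt => /orP [/eqP ->|/hN [s' lt_s' Ts']].
    by exists s => //; rewrite leq_max ltnSn orbT.
  by exists s' => //; rewrite leq_max lt_s'.
have [S0 typ0] := sound _ hj0.
(* From [N] on all smaller candidates are rejected, and [n > j0] brings [j0] itself into the range
   of the bounded search. *)
exists (maxn N j0.+1), (E o j0); split=> //; split=> // n.
rewrite geq_max => /andP [le_Nn lt_jn].
have := hA (learner_oracles g x n) n; rewrite locE.
rewrite (@bleastE _ _ j0) //.
  apply/bexistsP => -[s lt_sn]; rewrite locT //; exact/negP/hj0.
move=> i /hN [s lt_sN Ts]; rewrite negbK; apply/bexistsP; exists s.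
  exact: leq_trans lt_sN le_Nn.
by rewrite locT // (leq_trans lt_sN).
Qed.

(** * Refutations and deficiency *)

(** [CodeSeq.code] has the first entry outermost, so the code is built from the last letter inward,
    reading positions [m - i.+1]. *)
Definition xcode (o : nat -> nat -> nat) (m : nat) : nat :=
  nat_rect (fun _ => nat) 0 (fun i r => 2 ^ o 1 (m - i.+1) * (r + r).+1) m.

Lemma xcodeE o x m : (forall i, i < m -> o 1 i = x i) ->
  xcode o m = pickle (init x m).
Proof.
move=> ox; rewrite /xcode.
suff H k : k <= m -> nat_rect (fun _ => nat) 0
    (fun i r => 2 ^ o 1 (m - i.+1) * (r + r).+1) k =
    CodeSeq.code (map x (iota (m - k) k)).
  rewrite H // subnn /init /mkseq.
  by rewrite [RHS]/(CodeSeq.code _) map_id.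
elim: k => //= k IH lt_km; rewrite (IH (ltnW lt_km)) addnn ox; last by lia.
by rewrite (_ : m - k = (m - k.+1).+1) //; lia.
Qed.

Lemma cmp_xcode F : cmp F -> cmp (fun o x => xcode o (F o x)).
Proof.
apply: (cmp_comp (F := fun o x => xcode o x)).
by rewrite /xcode; auto 50 with cmp.
Qed.
#[global] Hint Resolve cmp_xcode : cmp.

(* [pickle (b :: p) = 2 ^ b * (2 * pickle p + 1)]; [prog] lists all programs
   together with their lengths. *)
Definition prog_step a z :=
  cpair (2 ^ (a != 0) * (pf z + pf z).+1) (ps z).+1.
Definition prog i := lfold prog_step i (cpair 0 0).

Lemma cmp_prog F : cmp F -> cmp (fun o x => prog (F o x)).
Proof.
apply: (cmp_comp (F := fun _ x => prog x)); rewrite /prog.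
have h : cmp (fun _ z => prog_step (pf z) (ps z)).
  by rewrite /prog_step; auto 50 with cmp.
by auto 50 with cmp.
Qed.
#[global] Hint Resolve cmp_prog : cmp.

Lemma lcode_surj n : exists l, n = lcode l.
Proof.
elim/ltn_ind: n => -[_|n IH]; first by exists [::].
have [l hl] := IH (ps n) (ps_le n).
by exists (pf n :: l); rewrite /= -hl /lcons cpair_pfps.
Qed.

Lemma prog_lcode l : let p := [seq a != 0 | a <- rev l] in
  prog (lcode l) = cpair (pickle p) (size p).
Proof.
rewrite /prog lfoldE -{1}(revK l) foldl_rev; elim: (rev l) => //= a s ->.
by rewrite /prog_step !pE addnn.
Qed.

Lemma prog_pickle i : exists p : seq bool, prog i = cpair (pickle p) (size p).
Proof. by have [l ->] := lcode_surj i; rewrite prog_lcode; eexists. Qed.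

Lemma pickle_prog (p : seq bool) : exists i, prog i = cpair (pickle p) (size p).
Proof.
exists (lcode (rev (map nat_of_bool p))); rewrite prog_lcode revK -map_comp.
by rewrite (@eq_map _ _ _ id) ?map_id // => -[].
Qed.

(** The inequality [qdec r + / 2 ^ n < / 2 ^ k] with denominators cleared; an approximation [r] of
    precision [n] then proves the measure smaller than [/ 2 ^ k]. *)
Definition below r n k : bool :=
  pf r * 2 ^ n * 2 ^ k + (ps r).+1 * 2 ^ k < (ps r).+1 * 2 ^ n.

(* Test number [s = (m, i, n, f)]: the [i]-th program makes [U] print the first
   [m] letters within [f] steps, while within [f] steps algorithm [e] shows, at
   precision [n], that their measure is smaller than 2 to the minus (length of
   the program + [c]). *)
Definition refutes (U : nat) (o : nat -> nat -> nat) (e c s : nat) : bool :=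
  let m := pf s in
  let i := pf (ps s) in
  let n := pf (ps (ps s)) in
  let f := ps (ps (ps s)) in
  [&& halted (nrun U (pf (prog i)) f),
      nresult (nrun U (pf (prog i)) f) == xcode o m,
      halted (nrun e (cpair (xcode o m) n) f) &
      below (nresult (nrun e (cpair (xcode o m) n) f)) n (ps (prog i) + c)].

Lemma cmp_refutes U F G H : cmp F -> cmp G -> cmp H ->
  cmp (fun o x => refutes U o (F o x) (G o x) (H o x)).
Proof.
apply: (cmp_comp3 (F := fun o x y z => nat_of_bool (refutes U o x y z))).
by rewrite /refutes /below; auto 50 with cmp.
Qed.
#[global] Hint Resolve cmp_refutes : cmp.

(** Test [s] reads only letters at positions below [pf s <= s], all visible at stage [n]. *)
Lemma refutes_local U g x n e c s : s < n ->
  refutes U (learner_oracles g x n) e c s = refutes U (full_oracle g x) e c s.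
Proof.
move=> lt_sn; rewrite /refutes.
have -> : xcode (learner_oracles g x n) (pf s) = pickle (init x (pf s)).
  apply: xcodeE => i lt_i /=; rewrite /learner_oracles /=.
  by rewrite ifT //; have := pf_le s; lia.
by rewrite (@xcodeE (full_oracle g x) x).
Qed.

Lemma refutes_sound U g x e c s : refutes U (full_oracle g x) e c s ->
  exists m (p : seq bool) n r, [/\ pmrun U p (pickle (init x m)),
    runs e (cpair (pickle (init x m)) n) r & below r n (size p + c)].
Proof.
have [p Ep] := prog_pickle (pf (ps s)).
rewrite /refutes Ep !pE (@xcodeE (full_oracle g x) x) //.
case/and4P => /nrun_sound hU /eqP EU /nrun_sound he hb.
by exists (pf s), p; do 2!eexists; split; [rewrite /pmrun -EU | exact: he | exact: hb].
Qed.

Lemma refutes_complete U g x e c m (p : seq bool) n r :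
  pmrun U p (pickle (init x m)) -> runs e (cpair (pickle (init x m)) n) r ->
  below r n (size p + c) -> exists s, refutes U (full_oracle g x) e c s.
Proof.
move=> /nrun_complete [N1 h1] /nrun_complete [N2 h2] hb.
have [i Ei] := pickle_prog p.
exists (cpair m (cpair i (cpair n (maxn N1 N2)))).
rewrite /refutes !pE Ei !pE (@xcodeE (full_oracle g x) x) //.
have [-> ->] := h1 _ (leq_maxl N1 N2); have [-> ->] := h2 _ (leq_maxr N1 N2).
by rewrite eqxx.
Qed.

(** * Comparing reals with powers of two *)

Section Dyadic.
Local Open Scope R_scope.

Lemma INR_expn n : INR (2 ^ n)%N = (2 ^ n)%R.
Proof.
elim: n => [|n IH] //=; rewrite expnS -IH -[(2 * _)%N]/(Nat.mul _ _).
by rewrite mult_INR.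
Qed.

Lemma pow2_gt0 n : 0 < 2 ^ n. Proof. by apply: pow_lt; lra. Qed.

Lemma Rabs_le_between a b : Rabs a <= b -> - b <= a <= b.
Proof. by have := Rle_abs a; have := Rle_abs (- a); rewrite Rabs_Ropp; lra. Qed.

Lemma inv_pow2_le m n : (m <= n)%N -> / 2 ^ n <= / 2 ^ m.
Proof.
move=> le_mn; apply: Rinv_le_contravar (pow2_gt0 m) _.
by apply: Rle_pow; [lra | apply/leP].
Qed.

(** The gap is used twice: once for the error of the approximation, once for the margin in
    [below]. *)
Lemma dyadic_gap (a b : R) : a < b -> exists n, a + / 2 ^ n + / 2 ^ n < b.
Proof.
move=> lt_ab; have [|n [hn /lt_0_INR n0]] := @archimed_cor1 ((b - a) / 2).
  by lra.
exists n; suff : / 2 ^ n < / INR n by lra.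
apply: Rinv_lt_contravar; first by apply: Rmult_lt_0_compat (pow2_gt0 n).
elim: {hn n0}n => [|n IH]; rewrite ?S_INR /=; first by lra.
have := @pow_R1_Rle 2 n; lra.
Qed.

Lemma belowP r n k : reflect (qdec r + / 2 ^ n < / 2 ^ k) (below r n k).
Proof.
have E : below r n k <-> (INR (pf r) * 2 ^ n * 2 ^ k + INR (ps r).+1 * 2 ^ k <
                      INR (ps r).+1 * 2 ^ n).
  rewrite -!INR_expn -!mult_INR -plus_INR /below; split.
    by move=> /ltP/lt_INR.
  by move=> /INR_lt/ltP.
have b0 : 0 < INR (ps r).+1 by apply/lt_0_INR/ltP.
have n0 := pow2_gt0 n; have k0 := pow2_gt0 k.
set d := INR (ps r).+1 * 2 ^ n * 2 ^ k.
have d0 : 0 < d by do 2!apply: Rmult_lt_0_compat => //.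
have E1 : qdec r + / 2 ^ n =
    (INR (pf r) * 2 ^ n * 2 ^ k + INR (ps r).+1 * 2 ^ k) / d.
  by rewrite /qdec -/(pf r) -/(ps r) /d; field; lra.
have E2 : / 2 ^ k = (INR (ps r).+1 * 2 ^ n) / d by rewrite /d; field; lra.
apply: (iffP idP) => [/E h|h].
  by rewrite E1 E2; apply: Rmult_lt_compat_r h; apply: Rinv_0_lt_compat.
apply/E; move: h; rewrite E1 E2; apply: Rmult_lt_reg_r.
exact: Rinv_0_lt_compat.
Qed.

Lemma log2_inv_le (a : R) n : 0 < a -> log2 (/ a) <= INR n <-> / 2 ^ n <= a.
Proof.
move=> a0; have n0 := pow2_gt0 n; have l2 : 0 < ln 2 by have := ln_lt_2; lra.
have E : log2 (/ a) <= INR n <-> ln (/ 2 ^ n) <= ln a.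
  rewrite /log2 !ln_Rinv // ln_pow; last by lra.
  rewrite -[INR n in X in X <-> _](Rmult_1_r (INR n)).
  have -> : - ln a / ln 2 <= INR n * 1 <->
            - ln a / ln 2 * ln 2 <= INR n * ln 2.
    split=> [h|]; first by apply: Rmult_le_compat_r; lra.
    by move/(Rmult_le_reg_r _ _ _ l2); rewrite Rmult_1_r.
  by rewrite (_ : - ln a / ln 2 * ln 2 = - ln a); [lra | field; lra].
rewrite E; split=> h.
  case: (Rle_lt_dec (/ 2 ^ n) a) => // /(ln_increasing _ _ a0); lra.
case: (Rle_lt_or_eq_dec _ _ h) => [lt|->]; last by lra.
by apply/Rlt_le/ln_increasing => //; apply: Rinv_0_lt_compat.
Qed.

End Dyadic.

(** * Never being refuted amounts to bounded deficiency and to typicality *)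

Definition never_refuted U g x e c :=
  forall s, ~~ refutes U (full_oracle g x) e c s.

(** Ranging over all programs instead of [Kc] makes a violation observable; the shortest program
    gives the strongest inequality. *)
Definition deficiency_bound U (mu : seq nat -> R) x c :=
  forall m p, pmrun U p (pickle (init x m)) ->
    Rle (Rinv (pow 2 (size p + c))) (mu (init x m)).

Lemma never_refutedP (L : seq nat) U g (x : nat -> nat) e c mu :
  (forall n, x n \in L) -> computes_measure L e mu ->
  never_refuted U g x e c <-> deficiency_bound U mu x c.
Proof.
move=> xL emu; have over_x m : Defs.over L (init x m).
  by apply/allP => _ /mapP [i _ ->].
split=> [unref m p hp|bound s].
  apply: Rnot_lt_le => lt_mu.
  have [n hn] := dyadic_gap lt_mu.
  have [r [hr /Rabs_le_between hmu]] := emu _ (over_x m) n.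
  have hb : below r n (size p + c) by apply/belowP; lra.
  have [s hs] := refutes_complete g hp hr hb.
  by have := unref s; rewrite hs.
apply/negP => /refutes_sound [m [p [n [r [hp hr /belowP hb]]]]].
have [r' [hr' /Rabs_le_between hmu]] := emu _ (over_x m) n.
(* Evaluation is deterministic, so the value in the refutation is the approximation that
   [computes_measure] vouches for. *)
have E := ev_functional hr hr'; rewrite -{}E in hmu.
have := bound m p hp; lra.
Qed.

Lemma decK : cancel enc dec.
Proof. by elim=> //= [f -> g ->|f -> g ->|f -> g ->|f ->]. Qed.

Lemma alg_index_of t : alg (index_of t) = t.
Proof. by rewrite /alg /index_of pickleK decK. Qed.

Lemma ev_snd o x y : ev o TSnd x y -> y = ps x.
Proof. by move=> h; inversion h. Qed.

(* U simulates a machine that halts on the empty program only, i.e. on input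
   [0 = pickle [::]]. *)
Lemma universal_program U y : universal_prefix_machine U -> exists p, pmrun U p y.
Proof.
case=> _ univ; have [k hk] := cmp_const y.
(* Each candidate of [TMu TSnd] is tested by returning the input itself, so the search halts exactly
   on input 0. *)
pose M := index_of (TComp k (TMu TSnd)).
have Mnil p z : pmrun M p z -> p = [::].
  rewrite /pmrun /runs alg_index_of => h; inversion h; subst.
  match goal with H : ev _ (TMu _) _ _ |- _ => inversion H; subst end.
  match goal with H : ev _ TSnd _ 0 |- _ => move: H => /ev_snd; rewrite psE end.
  by move=> E0; apply: (pcan_inj pickleK); rewrite -E0.
have [|sigma hs] := univ M; first by move=> p q a b /Mnil -> /Mnil ->.
exists (sigma ++ [::]); apply/hs; rewrite /pmrun /runs alg_index_of.
apply: (@evComp _ _ _ _ 0); last exact: hk.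
by apply: evMu => //; rewrite -[X in ev _ _ _ X](psE 0 0); constructor.
Qed.

Lemma typicalP U mu x : universal_prefix_machine U ->
  typical U mu x <-> exists c, deficiency_bound U mu x c.
Proof.
move=> univ; split=> [[c hc]|[c hc]].
  have [N hN] := INR_unbounded c; exists N => m p hp.
  have [mu0 hk] := hc m.
  (* Some program prints this prefix, hence a shortest one does, and its length is the
     complexity. *)
  have [k [[q [size_q hq]] kmin]] : exists k, Kc U (pickle (init x m)) k.
    elim/ltn_ind: {p}(size p) {-2}p (erefl (size p)) hp => n IH p size_p hp.
    have [[q [hq lt_q]]|min] := classic (exists q,
      pmrun U q (pickle (init x m)) /\ size q < n).
      exact: (IH _ lt_q q).
    exists n; split; first by exists p.
    move=> q hq; rewrite leqNgt; apply/negP => lt_q; apply: min.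
    by exists q.
  have := hk k (conj (ex_intro _ q (conj size_q hq)) kmin) => h.
  apply: Rle_trans (_ : Rle _ (Rinv (pow 2 (k + N)))) _.
    by apply: inv_pow2_le; rewrite leq_add2r; apply: kmin.
  apply/log2_inv_le => //; rewrite plus_INR; lra.
exists (INR c) => m.
(* [typical] also demands positive measure: some program prints the prefix, and the bound for it is
   positive. *)
have mu0 : Rlt R0 (mu (init x m)).
  have [p hp] := universal_program (pickle (init x m)) univ.
  apply: Rlt_le_trans (hc _ _ hp); exact/Rinv_0_lt_compat/pow2_gt0.
split=> // k [[p [<- hp]] _].
have /(log2_inv_le _ mu0) := hc _ _ hp; rewrite plus_INR; lra.
Qed.

Lemma typical_never_refuted (L : seq nat) U g (x : nat -> nat) e :
  universal_prefix_machine U -> (forall n, x n \in L) ->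
  typical_for_alg L U e x -> exists c, never_refuted U g x e c.
Proof.
move=> univ xL [mu [emu /(typicalP _ _ univ) [c hc]]].
by exists c; apply/(never_refutedP _ _ _ xL emu).
Qed.

Lemma never_refuted_typical (L : seq nat) U g (x : nat -> nat) e c :
  universal_prefix_machine U -> (forall n, x n \in L) -> measure_alg L e ->
  never_refuted U g x e c -> typical_for_alg L U e x.
Proof.
move=> univ xL [mu [_ emu]] /(never_refutedP _ _ _ xL emu) hc.
by exists mu; split=> //; apply/typicalP => //; exists c.
Qed.

(** * Learners from an enumeration of the set or of its complement *)

Unset Implicit Arguments.

Theorem theorem2 (L : seq nat) (U : nat) (S : nat -> Prop) :
  uniq L ->
  universal_prefix_machine U ->
  (forall e, S e -> measure_alg L e) ->
  (ce S ->
     exists A : term, forall g : nat -> nat, enumerates g S ->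
       forall x : nat -> nat, (forall n, x n \in L) ->
         (exists e, S e /\ typical_for_alg L U e x) ->
         identifies L U S A g x) /\
  (coce S ->
     exists A : term, forall g : nat -> nat, enumerates g (fun e => ~ S e) ->
       forall x : nat -> nat, (forall n, x n \in L) ->
         (exists e, S e /\ typical_for_alg L U e x) ->
         identifies L U S A g x).
Proof.
move=> _ univ Smeas; split=> _.
  (* Candidate [j] pairs a position in the enumeration with a constant, so every guess lies in
     [S]. *)
  have [||g x n j|g x n j s lt_sn|A hA] := @limit_learner U
    (fun o j => o 0 (pf j)) (fun o j s => refutes U o (o 0 (pf j)) (ps j) s);
    rewrite ?refutes_local //; auto 50 with cmp.
  exists A => g enum x xL [e [Se typ_e]]; apply: hA => [|j unref].
    have [m gm] := (enum e).1 Se.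
    have [c hc] := typical_never_refuted g univ xL typ_e.
    by exists (cpair m c) => s; rewrite !pE [full_oracle g x 0 m]gm.
  have Sj : S (g (pf j)) by apply/enum; exists (pf j).
  by split=> //; apply: never_refuted_typical univ xL (Smeas _ Sj) unref.
(* Candidate [j] pairs an arbitrary index with a constant; test [s] also rejects it when [g s] is
   that index. *)
have [||g x n j|g x n j s lt_sn|A hA] := @limit_learner U
  (fun _ => pf)
  (fun o j s => (o 0 s == pf j) || refutes U o (pf j) (ps j) s);
  rewrite ?refutes_local //; auto 50 with cmp.
exists A => g enum x xL [e [Se typ_e]]; apply: hA => [|j unref].
  have [c hc] := typical_never_refuted g univ xL typ_e.
  exists (cpair e c) => s; rewrite !pE negb_or hc andbT; apply/eqP => /= gs.
  by have /enum := ex_intro (fun m => g m = e) s gs; apply.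
have Sj : S (pf j).
  (* An index outside [S] would be listed at some [m], and test [m] would have rejected the
     candidate. *)
  apply: NNPP => /enum [m gm]; have := unref m.
  by rewrite [full_oracle g x 0 m]gm eqxx.
have unref_j : never_refuted U g x (pf j) (ps j).
  by move=> s; have := unref s; rewrite negb_or => /andP [].
by split=> //; apply: never_refuted_typical univ xL (Smeas _ Sj) unref_j.
Qed.
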